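(* Let $(X,d)$ be a complete metric space and let $T:X\to X$ be a self-mapping. For $x,y\in X$ put $$M_2(x,y)=\max\left\{ d(x,y),\ d(Tx,x),\ d(Ty,y),\ d(Tx,y),\ d(Ty,x)\right\}.$$ Suppose that: (1) there exists a function $\psi:\mathbb{R}^+\to\mathbb{R}^+$ such that $\psi(t)<t$ for each $t>0$ and $d(Tx,Ty)\le \frac12\psi(M_2(x,y))$ for all $x,y\in X$; (2) for every $\varepsilon>0$ there exists $\delta=\delta(\varepsilon)>0$ such that for all $x,y\in X$, $\varepsilon<M_2(x,y)<\varepsilon+\delta$ implies $d(Tx,Ty)\le\varepsilon$. Then $T$ has a unique fixed point $y_0\in X$, and $T^n x\to y_0$ as $n\to\infty$ for each $x\in X$. Also, $T$ is discontinuous at $y_0$ if and only if $\lim_{x\to y_0} M_2(x,y_0)\neq 0$.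
   Context: Metric spaces are nonempty. $\mathbb{R}^+=[0,\infty)$. $T^n$ denotes the $n$-fold iterate of $T$. The assertion $\lim_{x\to y_0}M_2(x,y_0)\neq 0$ means that it is not the case that $M_2(x,y_0)\to 0$ as $x\to y_0$ (i.e. the limit either does not exist or exists and is nonzero). *)

(* Defs.v *)
From HB Require Import structures.
From mathcomp Require Import all_boot all_order all_algebra.
From mathcomp Require Import all_classical all_reals all_analysis.

Set Implicit Arguments.
Unset Strict Implicit.
Unset Printing Implicit Defensive.

Import Order.TTheory GRing.Theory Num.Theory.
Import numFieldNormedType.Exports.

Local Open Scope classical_set_scope.
Local Open Scope ring_scope.

(* [Complete] includes [isPointed], so these spaces are nonempty. *)
#[short(type="completeMetricType")]
HB.structure Definition CompleteMetric (R : numDomainType) :=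
  {X of Complete X & Metric R X}.

Definition M2 (R : realType) (X : metricType R) (T : X -> X) (x y : X) : R :=
  Num.max (mdist x y)
    (Num.max (mdist (T x) x)
      (Num.max (mdist (T y) y)
        (Num.max (mdist (T x) y) (mdist (T y) x)))).

(* Main.v *)
Require Import Defs.
From HB Require Import structures.
From mathcomp Require Import all_boot all_order all_algebra.
From mathcomp Require Import all_classical all_reals all_analysis.
From mathcomp Require Import lra.

Set Implicit Arguments.
Unset Strict Implicit.
Unset Printing Implicit Defensive.

Import Order.TTheory GRing.Theory Num.Theory.
Import numFieldNormedType.Exports.

Local Open Scope classical_set_scope.
Local Open Scope ring_scope.

(** Since [psi t < t] for [t > 0], the first hypothesis gives
    [mdist (T x) (T y) <= 2^-1 * M2 T x y]: the map [T] is a quasi-contraction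
    in the sense of Ciric with constant [q = 2^-1 < 1], and the theorem follows
    from the theory of quasi-contractions with an arbitrary constant
    [0 <= q < 1].

    Existence and convergence rest on one remark: each of the five distances in
    [M2 T (T^i x) (T^j x)] is a distance between two points of the orbit with
    indices at least [min i j].  Hence the diameter of the orbit tail starting
    at [n + 1] is at most [q] times that of the tail starting at [n].  A finite
    piece of the orbit has its diameter [D] realised either by a pair of
    positive indices, or by a pair [x, T^j x], so the triangle inequality gives
    [D <= mdist x (T x) + q * D] (lemma [orbit_dist_improve]); this bounds the
    whole orbit (lemma [orbit_bounded]), the tails shrink geometrically (lemma
    [orbit_tail_dist]), and the orbit is Cauchy.  Comparing the orbit with its
    limit shows that the limit is fixed (lemma [orbit_limit_fixed]), and
    between two fixed points [M2] is just the distance, whence uniqueness.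

    At the fixed point [y0] one has
    [M2 T x y0 <= mdist x y0 + mdist (T x) y0], so that the quasi-contraction
    inequality yields [(1 - q) * mdist (T x) y0 <= q * mdist x y0].  Therefore
    [T] is continuous at [y0] and [M2 T x y0] tends to [0] as [x] tends to
    [y0]: both sides of the final equivalence are false. *)

(** * Quasi-contractions *)

Definition quasi_contraction (R : realType) (X : metricType R) (q : R)
    (T : X -> X) : Prop :=
  forall x y, mdist (T x) (T y) <= q * M2 T x y.

Section QuasiContraction.
Context (R : realType) (X : metricType R) (T : X -> X).

Lemma M2_le (x y : X) (c : R) : (M2 T x y <= c) =
  [&& mdist x y <= c, mdist (T x) x <= c, mdist (T y) y <= c,
      mdist (T x) y <= c & mdist (T y) x <= c].
Proof. by rewrite /M2 !ge_max. Qed.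

Lemma M2_ge0 (x y : X) : 0 <= M2 T x y.
Proof. by rewrite /M2 le_max mdist_ge0. Qed.

(** Where [M2 T x y = 0] the gauge [psi] gives no information, but there
    [T x = x = y = T y], so the left-hand side vanishes. *)
Lemma quasi_contraction_gauge (a : R) (psi : R -> R) : 0 <= a ->
  (forall t, 0 < t -> psi t < t) ->
  (forall x y, mdist (T x) (T y) <= a * psi (M2 T x y)) ->
  quasi_contraction a T.
Proof.
move=> a_ge0 psi_lt T_psi x y; have := M2_ge0 x y.
rewrite le_eqVlt => /predU1P[M0|M_gt0]; last first.
  by apply: le_trans (T_psi x y) _; rewrite ler_wpM2l// ltW// psi_lt.
have : M2 T x y <= 0 by rewrite -M0.
rewrite M2_le => /and5P[xy Txx _ Txy Tyx].
rewrite -M0 mulr0 (le_trans (metric_triangle _ x _))//.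
by rewrite -[leRHS]addr0 lerD// metric_sym.
Qed.

Variable q : R.
Hypothesis q_ge0 : 0 <= q.
Hypothesis q_lt1 : q < 1.
Hypothesis T_qc : quasi_contraction q T.

(** * Orbits *)

(** The points compared by [M2] at [T^i x], [T^j x] have indices among
    [i], [j], [i + 1], [j + 1], which is why [i] and [j] stop short of [N]:
    the bound [D] must still be available one step later. *)
Lemma orbit_dist_contract (x : X) (D : R) (m N i j : nat) :
  (forall k l, (m <= k <= N)%N -> (m <= l <= N)%N ->
     mdist (iter k T x) (iter l T x) <= D) ->
  (m <= i < N)%N -> (m <= j < N)%N ->
  mdist (iter i.+1 T x) (iter j.+1 T x) <= q * D.
Proof.
move=> dD /andP[mi iN] /andP[mj jN].
have [iN' jN'] := (ltnW iN, ltnW jN).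
have [mi' mj'] := (leqW mi, leqW mj).
rewrite !iterS (le_trans (T_qc _ _))// ler_wpM2l// M2_le -!iterS.
by rewrite !dD ?mi ?mj ?iN ?jN ?mi' ?mj' ?iN' ?jN'.
Qed.

(** A bound [D] on an initial piece of the orbit improves itself: a pair of
    positive indices gains the factor [q], and a pair [x, T^j x] is reduced to
    such a pair by one detour through [T x]. *)
Lemma orbit_dist_improve (x : X) (D : R) (N : nat) :
  (forall i j, (i <= N)%N -> (j <= N)%N ->
     mdist (iter i T x) (iter j T x) <= D) ->
  forall i j, (i <= N)%N -> (j <= N)%N ->
     mdist (iter i T x) (iter j T x) <= mdist x (T x) + q * D.
Proof.
move=> dD.
have D_ge0 : 0 <= D by rewrite (le_trans _ (dD 0 0 _ _))%N// mdist_ge0.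
have qD_ge0 : 0 <= q * D by rewrite mulr_ge0.
have contract i j : (i < N)%N -> (j < N)%N ->
    mdist (iter i.+1 T x) (iter j.+1 T x) <= q * D.
  by move=> iN jN; apply: (@orbit_dist_contract _ _ 0 N).
have from0 j : (j < N)%N ->
    mdist x (iter j.+1 T x) <= mdist x (T x) + q * D.
  move=> jN; rewrite (le_trans (metric_triangle _ (T x) _))// lerD2l.
  by apply: (contract 0%N) => //; apply: leq_ltn_trans jN.
case=> [|i] [|j] iN jN.
- by rewrite mdistxx addr_ge0// mdist_ge0.
- exact: from0.
- by rewrite metric_sym from0.
- by rewrite (le_trans (contract _ _ iN jN))// lerDr mdist_ge0.
Qed.

(** Applied to the maximal distance [D] in a finite piece of the orbit,
    self-improvement becomes the inequality [D <= mdist x (T x) + q * D], whose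
    solution for [D] is independent of the length of the piece. *)
Lemma orbit_bounded (x : X) (i j : nat) :
  mdist (iter i T x) (iter j T x) <= mdist x (T x) / (1 - q).
Proof.
pose N := maxn i j.
pose d (p : 'I_N.+1 * 'I_N.+1) := mdist (iter p.1 T x) (iter p.2 T x).
pose D := \big[Num.max/0]_p d p.
have dD k l : (k <= N)%N -> (l <= N)%N ->
    mdist (iter k T x) (iter l T x) <= D.
  rewrite -(ltnS k) -(ltnS l) => kN lN.
  exact: (le_bigmax 0 d (Ordinal kN, Ordinal lN)).
have dD' := orbit_dist_improve dD.
have D_le : D <= mdist x (T x) + q * D.
  apply: bigmax_le => [|[k l] _]; last by apply: dD'; rewrite -ltnS.
  by apply: le_trans (dD' 0 0 _ _)%N => //; rewrite mdist_ge0.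
apply: (@le_trans _ _ D); first by rewrite dD ?leq_maxl ?leq_maxr.
by rewrite ler_pdivlMr ?subr_gt0//; nra.
Qed.

(** Each index removed from the front of the orbit costs the diameter of the
    tail a factor [q], since a distance in the tail starting at [n + 1] is a
    distance between images of points of the tail starting at [n]. *)
Lemma orbit_tail_dist (x : X) (n i j : nat) : (n <= i)%N -> (n <= j)%N ->
  mdist (iter i T x) (iter j T x) <= q ^+ n * (mdist x (T x) / (1 - q)).
Proof.
elim: n i j => [|n IHn] [|i] [|j] // ni nj;
  rewrite ?expr0 ?mul1r; try exact: orbit_bounded.
rewrite exprS -mulrA.
apply: (@orbit_dist_contract _ _ n (maxn i j).+1) => [k l||].
- by move=> /andP[nk _] /andP[nl _]; apply: IHn.
- by rewrite -ltnS ni ltnS leq_maxl.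
- by rewrite -ltnS nj ltnS leq_maxr.
Qed.

Lemma orbit_cauchy (x : X) : cauchy (iter n T x @[n --> \oo]).
Proof.
apply: cauchy_exP => e e_gt0.
pose C := mdist x (T x) / (1 - q).
have qC0 : q ^+ n * C @[n --> \oo] --> (0 : R).
  rewrite -(mul0r C); apply: cvgMl; apply: cvg_expr.
  by rewrite ger0_norm.
have [N _ qNC] := (cvgr_lt _ qC0 _ e_gt0).
exists (iter N T x); exists N => // n /= Nn.
rewrite ballEmdist/=; apply: le_lt_trans (qNC N (leqnn N)).
exact: orbit_tail_dist.
Qed.

(** * Fixed points *)

(** With [D = mdist z (T z)] and an orbit point within [e] of [z], together
    with its successor, all five distances in [M2] are at most [2 * e + D], so
    [D <= e + q * (2 * e + D)]; the factor [q < 1] absorbs [D] on the right. *)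
Lemma orbit_limit_fixed (x z : X) :
  iter n T x @[n --> \oo] --> z -> T z = z.
Proof.
move=> xz; apply/esym/(@mdist_positivity R).
apply/eqP; rewrite eq_le mdist_ge0 andbT.
set D := mdist z (T z).
suff D_le (e : R) : 0 < e -> (1 - q) * D <= 3 * e.
  rewrite -(@pmulr_rle0 _ (1 - q)) ?subr_gt0//.
  apply/ler_addgt0Pl => e e_gt0; rewrite addr0.
  by have := D_le (e / 3); rewrite divr_gt0// => /(_ isT); lra.
move=> e_gt0.
have [N _ near_z] := metricType_numDomainType.cvgr_dist_le xz e_gt0.
have zN : mdist z (iter N T x) <= e by apply: near_z => /=.
have zN1 : mdist z (iter N.+1 T x) <= e by apply: near_z => /=.
move: zN zN1; rewrite iterS; set u := iter N T x => zu zTu.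
have M_le : M2 T u z <= 2 * e + D.
  have D_ge0 : 0 <= D by exact: mdist_ge0.
  have uTu := metric_triangle (T u) z u.
  have Tzu := metric_triangle (T z) z u.
  rewrite M2_le; move: uTu Tzu.
  rewrite (metric_sym u z) (metric_sym (T u) z) (metric_sym (T z) z) -/D.
  by move=> uTu Tzu; apply/and5P; split; lra.
have := le_trans (metric_triangle z (T u) (T z)) (lerD zTu (T_qc u z)).
have := ler_wpM2l q_ge0 M_le.
have : q * e <= e by rewrite ler_piMl ?ltW.
by rewrite -/D; lra.
Qed.

Lemma fixed_point_unique (y z : X) : T y = y -> T z = z -> y = z.
Proof.
move=> Ty Tz; apply: (@mdist_positivity R); apply/eqP.
rewrite eq_le mdist_ge0 andbT.
have M_le : M2 T y z <= mdist y z.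
  by rewrite M2_le Ty Tz !mdistxx lexx (metric_sym z y) lexx mdist_ge0.
rewrite -(@pmulr_rle0 _ (1 - q)) ?subr_gt0//.
have := T_qc y z; have := ler_wpM2l q_ge0 M_le; rewrite Ty Tz; lra.
Qed.

(** * Behaviour near a fixed point *)

Lemma near_dist_le (y : X) (e : R) : 0 < e ->
  \forall x \near y, mdist y x <= e.
Proof.
move=> e_gt0; apply: filterS (nbhsx_ballx y e e_gt0) => x.
by rewrite ballEmdist => /ltW.
Qed.

Lemma M2_fixed_le (x y : X) : T y = y ->
  M2 T x y <= mdist x y + mdist (T x) y.
Proof.
move=> Ty; have xy_ge0 := mdist_ge0 x y; have Txy_ge0 := mdist_ge0 (T x) y.
have := metric_triangle (T x) y x; rewrite (metric_sym y x) => Txx.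
rewrite M2_le Ty mdistxx (metric_sym y x).
by apply/and5P; split; lra.
Qed.

(** Inserting [M2_fixed_le] in [mdist (T x) (T y) <= q * M2 T x y] puts
    the left-hand side on the right with the factor [q < 1], so it can be
    absorbed: at a fixed point a quasi-contraction is Lipschitz. *)
Lemma dist_image_fixed_le (x y : X) : T y = y ->
  mdist (T x) y <= q / (1 - q) * mdist x y.
Proof.
move=> Ty; rewrite mulrAC ler_pdivlMr ?subr_gt0//.
have := T_qc x y; have := ler_wpM2l q_ge0 (M2_fixed_le x Ty).
by rewrite Ty; lra.
Qed.

Lemma continuous_at_fixed (y : X) : T y = y -> {for y, continuous T}.
Proof.
move=> Ty; rewrite /prop_for /continuous_at Ty.
apply/(@metricType_numDomainType.cvgrPdist_le R X) => e e_gt0.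
(* The Lipschitz constant is enlarged by [1] to be positive also for [q = 0]. *)
pose K := 1 + q / (1 - q).
have K_ge0 : 0 <= q / (1 - q) by rewrite divr_ge0// subr_ge0 ltW.
have K_gt0 : 0 < K by rewrite ltr_pwDl.
have eK_gt0 := divr_gt0 e_gt0 K_gt0.
have := near_dist_le y eK_gt0.
apply: filterS => x /=; rewrite ler_pdivlMr// (metric_sym y (T x)) => yx.
apply: le_trans (dist_image_fixed_le x Ty) _; rewrite metric_sym.
by have := mdist_ge0 y x; rewrite /K in yx *; lra.
Qed.

Lemma M2_cvg0_of_continuous (y : X) : T y = y -> {for y, continuous T} ->
  M2 T x y @[x --> y] --> (0 : R).
Proof.
move=> Ty; rewrite /prop_for /continuous_at Ty => Tcont.
apply/cvgr0Pnorm_le => e e_gt0.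
have e2_gt0 : 0 < e / 2 by rewrite divr_gt0.
have near_id := near_dist_le y e2_gt0.
have near_T : \forall x \near y, mdist y (T x) <= e / 2.
  exact: (metricType_numDomainType.cvgr_dist_le Tcont e2_gt0).
near=> x.
have yx : mdist y x <= e / 2 by near: x.
have yTx : mdist y (T x) <= e / 2 by near: x.
rewrite ger0_norm ?M2_ge0// (le_trans (M2_fixed_le x Ty))//.
by rewrite (metric_sym x) (metric_sym (T x)); lra.
Unshelve. all: by end_near. Qed.

End QuasiContraction.

Theorem theorem2p8 (R : realType) (X : completeMetricType R) (T : X -> X)
  (contraction : exists psi : R -> R,
     [/\ forall t, 0 <= t -> 0 <= psi t,
         forall t, 0 < t -> psi t < t &
         forall x y, mdist (T x) (T y) <= 2^-1 * psi (M2 T x y)])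
  (eps_delta : forall eps : R, 0 < eps -> exists2 delta : R, 0 < delta &
     forall x y, eps < M2 T x y < eps + delta -> mdist (T x) (T y) <= eps) :
  exists y0 : X,
    [/\ T y0 = y0,
        forall y, T y = y -> y = y0,
        forall x, iter n T x @[n --> \oo] --> y0 &
        ~ {for y0, continuous T} <-> ~ (M2 T x y0 @[x --> y0^'] --> (0 : R))].
Proof.
have [psi [_ psi_lt T_psi]] := contraction.
have half_ge0 : 0 <= 2^-1 :> R by rewrite invr_ge0.
have half_lt1 : 2^-1 < 1 :> R by lra.
have T_qc := quasi_contraction_gauge half_ge0 psi_lt T_psi.
have cvg_fixed x : exists2 z, T z = z & iter n T x @[n --> \oo] --> z.
  have /cauchy_cvgP/cvg_ex[z xz] := orbit_cauchy half_ge0 half_lt1 T_qc x.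
  by exists z => //; apply: (orbit_limit_fixed half_ge0 half_lt1 T_qc xz).
have [y0 Ty0 _] := cvg_fixed point.
have y0_uniq y : T y = y -> y = y0.
  by move=> Ty; apply: (fixed_point_unique half_ge0 half_lt1 T_qc).
exists y0; split => // [x|].
  by have [z /y0_uniq ->] := cvg_fixed x.
have Tcont := continuous_at_fixed half_ge0 half_lt1 T_qc Ty0.
split=> [/(_ Tcont)//|[]].
exact: cvg_within_filter (M2_cvg0_of_continuous Ty0 Tcont).
Qed.
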